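(* Let $H$ be a weighted oriented whisker of a weighted oriented graph $D$, where $V(D)=\{x_1,\dots,x_n\}$ and $V(H)=V(D)\cup\{y_1,\dots,y_n\}$ (with $y_i$ the whisker vertex attached to $x_i$), and let $w$ be the weight function of $H$. Then the following conditions are equivalent: 1) $I(H)$ is unmixed. 2) If $(x_i,y_i)\in E(H)$ for some $1\le i\le n$, then $w(x_i)=1$.
   Context: A weighted oriented graph is a triplet $D=(V(D),E(D),w)$ where $V(D)$ is a finite set, $E(D)\subseteq V(D)\times V(D)$ is the edge set of an oriented graph (no loops, and for $x\neq y$ at most one of $(x,y),(y,x)$ is in $E(D)$), and $w:V(D)\to\mathbb{N}=\{1,2,\dots\}$ is the weight function. Its underlying graph is the simple graph on $V(D)$ with edge set $\{\{x,y\}:(x,y)\in E(D)\}$. A source is a vertex with no in-neighbours, i.e. a vertex $x$ such that there is no $(y,x)$ in the edge set. Standing assumption (applied here to $H$): every source of $H$ has weight $1$. A whisker of a simple graph $G$ with $V(G)=\{x_1,\dots,x_n\}$ is a graph with vertex set $V(G)\cup\{y_1,\dots,y_n\}$ (the $y_i$ being new vertices) and edge set $E(G)\cup\{\{x_1,y_1\},\dots,\{x_n,y_n\}\}$. A weighted oriented graph $H$ is a weighted oriented whisker of $D$ if $D\subseteq H$ (as weighted oriented graphs: $V(D)\subseteq V(H)$, $E(D)\subseteq E(H)$, and the weights of $D$ are the restrictions of those of $H$) and the underlying graph of $H$ is a whisker of the underlying graph of $D$. The edge ideal $I(H)$ is the ideal of the polynomial ring over a field $K$ whose variables are the vertices of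 $H$, generated by the monomials $ab^{w(b)}$ for $(a,b)\in E(H)$. An ideal is unmixed if all its associated primes have the same height. *)

(* Defs.v *)
From HB Require Import structures.
From mathcomp Require Import all_boot all_order all_algebra.
From mathcomp Require Import mpoly.

Set Implicit Arguments.
Unset Strict Implicit.
Unset Printing Implicit Defensive.

Import GRing.Theory.
Local Open Scope ring_scope.

(* All graphs live in an ambient finite type T, so that inclusion between them
   is literal inclusion of vertex and edge sets. *)

Record sgraph (T : finType) := SGraph {
  svertices : {set T};
  sedges : {set {set T}};
  sedges_vertices : forall e, e \in sedges -> e \subset svertices;
  sedges_card : forall e, e \in sedges -> #|e| = 2
}.

(* The values of [weight] outside [vertices] carry no information. *)
Record wograph (T : finType) := WOGraph {
  vertices : {set T};
  edges : {set T * T};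
  weight : T -> nat;
  edges_vertices : forall a b, (a, b) \in edges ->
    (a \in vertices) && (b \in vertices);
  edges_irrefl : forall a, (a, a) \notin edges;
  edges_asym : forall a b, (a, b) \in edges -> (b, a) \notin edges;
  weight_gt0 : forall a, a \in vertices -> (0 < weight a)%N
}.

Section Graphs.
Variable T : finType.
Implicit Types (G : sgraph T) (D H : wograph T).

Definition uedges D : {set {set T}} := [set [set e.1; e.2] | e in edges D].

Lemma uedges_vertices D e : e \in uedges D -> e \subset vertices D.
Proof.
case/imsetP=> -[a b] /edges_vertices /andP[Va Vb] ->.
by apply/subsetP=> z /=; rewrite !inE => /orP[] /eqP->.
Qed.

Lemma uedges_card D e : e \in uedges D -> #|e| = 2.
Proof.
case/imsetP=> -[a b] Eab -> /=; rewrite cards2.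
by case: eqP Eab => // ->; rewrite (negPf (edges_irrefl D b)).
Qed.

Definition underlying D : sgraph T :=
  SGraph (@uedges_vertices D) (@uedges_card D).

Definition source D a : Prop :=
  a \in vertices D /\ (forall b, (b, a) \notin edges D).

Definition wosubgraph D H : Prop :=
  [/\ vertices D \subset vertices H, edges D \subset edges H
    & {in vertices D, weight D =1 weight H}].

(* G' is the whisker of G = {x_0, ..., x_(n-1)} in which the new vertex y_i is
   attached to x_i. *)
Definition whisker G G' n (x y : 'I_n -> T) : Prop :=
  [/\ injective x /\ svertices G = [set x i | i : 'I_n],
      injective y /\ (forall i, y i \notin svertices G),
      svertices G' = svertices G :|: [set y i | i : 'I_n]
    & sedges G' = sedges G :|: [set [set x i; y i] | i : 'I_n]].

Definition wowhisker D H n (x y : 'I_n -> T) : Prop :=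
  wosubgraph D H /\ whisker (underlying D) (underlying H) x y.

End Graphs.

Section Ideals.
Variable R : comNzRingType.
Implicit Types I J P Q S : R -> Prop.

Definition is_ideal I : Prop :=
  [/\ I 0, forall a b, I a -> I b -> I (a + b)
    & forall a b, I b -> I (a * b)].

Definition ideal_gen S : R -> Prop :=
  fun f => forall J, is_ideal J -> (forall s, S s -> J s) -> J f.

Definition is_prime P : Prop :=
  [/\ is_ideal P, ~ P 1 & forall a b, P (a * b) -> P a \/ P b].

(* P is a prime of the form (I : f). *)
Definition associated_prime I P : Prop :=
  is_prime P /\ exists f, forall g, P g <-> I (g * f).

Definition strict_sub P Q : Prop :=
  (forall f, P f -> Q f) /\ exists2 f, Q f & ~ P f.

(* A chain C_0 < C_1 < ... < C_h = P of prime ideals. *)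
Definition prime_chain P h (C : nat -> R -> Prop) : Prop :=
  [/\ forall i, (i <= h)%N -> is_prime (C i),
      forall i, (i < h)%N -> strict_sub (C i) (C i.+1)
    & forall f, C h f <-> P f].

Definition has_height P h : Prop :=
  (exists C, prime_chain P h C) /\
  (forall k C, prime_chain P k C -> (k <= h)%N).

(* The height of a prime lies in nat or is infinite (no h with [has_height]);
   the equivalence below is equality of heights in both cases. *)
Definition unmixed I : Prop :=
  forall P Q, associated_prime I P -> associated_prime I Q ->
    forall h, has_height P h <-> has_height Q h.

End Ideals.

(* The variable 'X_i stands for the vertex [enum_val i], so the polynomial ring
   has exactly the vertices of H as variables. *)
Definition edge_monomial (K : fieldType) (T : finType) (H : wograph T)
    (f : {mpoly K[#|vertices H|]}) : Prop :=
  exists i j : 'I_#|vertices H|,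
    (enum_val i, enum_val j) \in edges H /\
    f = 'X_i * 'X_j ^+ weight H (enum_val j).

Definition edge_ideal (K : fieldType) (T : finType) (H : wograph T) :
    {mpoly K[#|vertices H|]} -> Prop :=
  ideal_gen (@edge_monomial K T H).
Arguments edge_ideal K {T} H.

(* Main.v *)
(* Every associated prime of a monomial ideal is generated by a set C of
   variables, and for an edge ideal C is a vertex cover, hence contains x_i or
   y_i for each i.

   If (I : f) is generated by C, some monomial m of f lies outside I while
   X_v m lies in I for every v in C.  If x_i and y_i were both in C, then
   X_(y_i) m in I forces x_i to divide m, to the power w(x_i) when the edge is
   (y_i, x_i); under condition 2 this makes X_(x_i) m in I imply m in I.  So
   |C| = n, and two such primes are exchanged by a permutation of the variables.

   Conversely, let (x_i, y_i) be an edge with w(x_i) > 1.  Then x_i is not a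
   source, so there is an edge (x_j, x_i).  The strong vertex cover
   C = {x_k : k <> j} + {y_j} and its enlargement C + {y_i} both give associated
   primes, one strictly inside the other.  Their heights differ because
   chains of primes are bounded: elements f_i of C_(i+1) not in C_i are
   algebraically independent, and counting monomials allows at most N of them
   in N variables. *)

Require Import Defs.
From mathcomp Require Import all_boot all_order all_algebra.
From mathcomp Require Import perm.
From mathcomp Require Import mpoly.

Set Implicit Arguments.
Unset Strict Implicit.
Unset Printing Implicit Defensive.

Import GRing.Theory.
Local Open Scope ring_scope.

(** * Closure properties of ideals *)

Section Ideal.
Variables (R : comNzRingType) (J : R -> Prop).
Hypothesis Jideal : is_ideal J.

Lemma ideal0 : J 0. Proof. by case: Jideal. Qed.
Lemma idealD a b : J a -> J b -> J (a + b).
Proof. by case: Jideal => _ h _; apply: h. Qed.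
Lemma idealM a b : J b -> J (a * b).
Proof. by case: Jideal => _ _; apply. Qed.
Lemma idealB a b : J a -> J b -> J (a - b).
Proof. by move=> Ja Jb; apply: idealD => //; rewrite -mulN1r; apply: idealM. Qed.
Lemma ideal_sum (I : eqType) (r : seq I) (F : I -> R) :
  {in r, forall i, J (F i)} -> J (\sum_(i <- r) F i).
Proof.
move=> h; rewrite big_seq; apply: (big_ind J); [exact: ideal0 | exact: idealD |].
by move=> i /h.
Qed.

End Ideal.

(** * Monomial ideals, primes generated by variables, and associated primes *)

Section MonomialIdeals.
Variables (K : fieldType) (N : nat).
Implicit Types (C : {set 'I_N}) (S : pred 'X_{1..N}) (f g : {mpoly K[N]}) (m u : 'X_{1..N}).

Definition upclosed S := forall u m, S m -> S (u + m)%MM.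

(** Stated through the support, so membership is decidable; it is an ideal once [S] is
    [upclosed]. *)
Definition monomial_ideal S f : Prop := all S (msupp f).

Lemma monomial_idealP S f :
  monomial_ideal S f <-> (forall m, f@_m != 0 -> S m).
Proof.
split=> [/allP h m | h]; first by rewrite -mcoeff_msupp => /h.
by apply/allP=> m; rewrite mcoeff_msupp => /h.
Qed.

Lemma monomial_idealX S m : monomial_ideal S 'X_[m] <-> S m.
Proof. by rewrite /monomial_ideal msuppX /= andbT. Qed.

Lemma is_ideal_monomial S : upclosed S -> is_ideal (monomial_ideal S).
Proof.
move=> upS; split; rewrite /monomial_ideal ?msupp0 //.
- move=> a b /allP ha /allP hb; apply/allP=> m /msuppD_le.
  by rewrite mem_cat => /orP[/ha|/hb].
- move=> a b /allP hb; apply/allP=> m /msuppM_le /allpairsP[[u v] /= [_ hv ->]].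
  exact/upS/hb.
Qed.

Lemma monomial_ideal_sub (J : {mpoly K[N]} -> Prop) S f : is_ideal J ->
  (forall m, S m -> J 'X_[m]) -> monomial_ideal S f -> J f.
Proof.
move=> Jideal hS /allP hf; rewrite (mpolyE f); apply: (ideal_sum Jideal) => m /hf/hS.
by rewrite -mul_mpolyC; apply: (idealM Jideal).
Qed.

(** The remainder [g] keeps the terms of [f] outside [S]; it serves as a normal form modulo the
    ideal. *)
Lemma monomial_reduce S f : exists g,
  monomial_ideal S (f - g) /\ {in msupp g, forall m, ~~ S m}.
Proof.
have E : f - \sum_(m <- msupp f | ~~ S m) f@_m *: 'X_[m] =
         \sum_(m <- msupp f | S m) f@_m *: 'X_[m].
  by rewrite {1}[f]mpolyE (bigID S) /= addrK.
exists (\sum_(m <- msupp f | ~~ S m) f@_m *: 'X_[m]); split.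
  rewrite E; apply/allP=> m /msupp_sum_le /flattenP[s /mapP[u]].
  rewrite mem_filter => /andP[Su _] -> /msuppZ_le.
  by rewrite msuppX inE => /eqP->.
move=> m /msupp_sum_le /flattenP[s /mapP[u]].
rewrite mem_filter => /andP[Su _] -> /msuppZ_le.
by rewrite msuppX inE => /eqP->.
Qed.

(** Both factors may be replaced by their normal forms. If neither is 0, the leading monomial of the
    product is the product of two monomials outside [S], yet it must lie in [S]. *)
Lemma is_prime_monomial S : upclosed S -> ~~ S 0%MM ->
  (forall m u, S (m + u)%MM -> S m || S u) -> is_prime (monomial_ideal S).
Proof.
move=> upS S0 SD; have SI := is_ideal_monomial upS; split=> //.
  by rewrite -mpolyX0 => /monomial_idealX; apply/negP.
move=> a b hab.
have [a' [ha na]] := monomial_reduce S a; have [b' [hb nb]] := monomial_reduce S b.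
have [a0|a0] := eqVneq a' 0; first by left; rewrite a0 subr0 in ha.
have [b0|b0] := eqVneq b' 0; first by right; rewrite b0 subr0 in hb.
have hab' : monomial_ideal S (a' * b').
  have -> : a' * b' = a * b - (b * (a - a') + a' * (b - b')).
    rewrite !mulrBr (mulrC b a) (mulrC b a') addrA subrK.
    by rewrite opprB addrCA subrr addr0.
  by apply: (idealB SI hab); apply: (idealD SI); apply: (idealM SI).
have : S (mlead (a' * b')).
  by apply: (allP hab'); apply: mlead_supp; rewrite mulf_neq0.
rewrite mleadM // => /SD.
by rewrite (negPf (na _ (mlead_supp a0))) (negPf (nb _ (mlead_supp b0))).
Qed.

(* The product of the two leading monomials occurs in g f, so multiplying f by
   the leading monomial of g removes its leading term modulo the ideal. *)
Lemma monomial_colon_lead S f g : upclosed S -> g != 0 ->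
  monomial_ideal S (g * f) ->
  exists k, monomial_ideal S ('X_[mlead g *+ k] * f).
Proof.
move=> upS g0; have SI := is_ideal_monomial upS.
have [l] := ubnP (size (msupp f)); elim: l f => // l IHl f lt_f hgf.
have [->|f0] := eqVneq f 0.
  by exists 0%N; rewrite mulr0; apply: ideal0 SI.
pose u := mlead g; pose m := mlead f; pose f' := f - f@_m *: 'X_[m].
have Sum : S (u + m)%MM.
  by rewrite -mleadM //; apply: (allP hgf); rewrite mlead_supp // mulf_neq0.
have hum : monomial_ideal S ('X_[u] * 'X_[m]).
  by rewrite -mpolyXD; apply/monomial_idealX.
(* Multiplying by a monomial only shifts the support, so removing the leading term of [f] shortens
   it. *)
have sz : (size (msupp ('X_[u] * f')) < l)%N.
  rewrite mulrC (perm_size (msuppMX _ _)) size_map.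
  have := perm_size (msupp_rem f m); rewrite -/f' => ->.
  rewrite size_rem ?mlead_supp // -ltnS prednK //.
  by rewrite lt0n size_eq0 msupp_eq0.
have hcm (h : {mpoly K[N]}) :
    monomial_ideal S (h * 'X_[u] * (f@_m *: 'X_[m])).
  by rewrite -scalerAr -mulrA -mul_mpolyC; do 2 apply: (idealM SI).
case: (IHl _ sz) => [|k hk].
  rewrite mulrA mulrBr; apply: (idealB SI) => //.
  by rewrite -mulrA mulrCA; apply: (idealM SI).
exists k.+1; have -> : 'X_[u *+ k.+1] * f =
   'X_[u *+ k] * ('X_[u] * f') + 'X_[u *+ k] * 'X_[u] * (f@_m *: 'X_[m]).
  by rewrite mulrA -mulrDr subrK -mpolyXD mulmSr.
exact: (idealD SI).
Qed.

Definition meets C : pred 'X_{1..N} :=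
  fun m => [exists i in C, 0 < m i]%N.

Lemma meetsP C m : reflect (exists2 i, i \in C & 0 < m i)%N (meets C m).
Proof. exact: exists_inP. Qed.

Lemma meets_upclosed C : upclosed (meets C).
Proof.
move=> u m /meetsP[i Ci mi]; apply/meetsP; exists i => //.
by rewrite mnmDE addn_gt0 mi orbT.
Qed.

Lemma meetsD C m u : meets C (m + u)%MM = meets C m || meets C u.
Proof.
apply/idP/orP => [/meetsP[i Ci]|[]].
- rewrite mnmDE addn_gt0 => /orP[] h; [left|right]; apply/meetsP; exists i => //.
- by move=> h; rewrite addmC; apply: meets_upclosed.
- exact: meets_upclosed.
Qed.

Lemma meets0 C : ~~ meets C 0%MM.
Proof. by apply/meetsP=> -[i _]; rewrite mnm0E. Qed.

Lemma meets1 C i : meets C U_(i)%MM = (i \in C).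
Proof.
apply/meetsP/idP => [[j Cj]|Ci]; last by exists i => //; rewrite mnm1E eqxx.
by rewrite mnm1E; case: eqP => // ->.
Qed.

Definition var_prime C : {mpoly K[N]} -> Prop :=
  monomial_ideal (meets C).

Lemma is_prime_var C : is_prime (@var_prime C).
Proof.
apply: is_prime_monomial; [exact: meets_upclosed | exact: meets0 |].
by move=> m u; rewrite meetsD.
Qed.

Lemma prime_monomial (P : {mpoly K[N]} -> Prop) m : is_prime P -> P 'X_[m] ->
  exists2 i, (0 < m i)%N & P 'X_i.
Proof.
move=> [PI P1 PM]; rewrite mpolyXE_id.
have h (a : {mpoly K[N]}) k : P (a ^+ k) -> (0 < k)%N /\ P a.
  elim: k => [/P1 //|k IH]; rewrite exprS => /PM[|/IH[]] //.
have gen (r : seq 'I_N) : P (\prod_(i <- r) 'X_i ^+ m i) ->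
    exists2 i, (0 < m i)%N & P 'X_i.
  elim: r => [|i r IH]; first by rewrite big_nil => /P1.
  by rewrite big_cons => /PM[/h[]|/IH //]; exists i.
exact: gen.
Qed.

(** [C] consists of the variables in [P], and [m] is a monomial of [f] outside [S]. If a normal form
    of some [g] in [P] were nonzero, a power of its leading monomial would multiply [f] into the
    ideal; by primality a variable of that monomial would lie in [C], which normal forms exclude. *)
Lemma associated_monomial S P : upclosed S ->
  associated_prime (monomial_ideal S) P ->
  exists (C : {set 'I_N}) m, [/\ forall f, P f <-> var_prime C f, ~~ S m
    & {in C, forall i, S (U_(i) + m)%MM}].
Proof.
move=> upS [Pp [f hf]]; have SI := is_ideal_monomial upS.
have [PI P1 PM] := Pp.
pose C := [set i : 'I_N | all S (msupp ('X_i * f))].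
have CP i : P 'X_i <-> i \in C by rewrite inE; apply: hf.
have : ~~ all S (msupp f).
  by apply/negP=> Sf; apply: P1; apply/hf; rewrite mul1r.
case/allPn=> m fm Sm; exists C, m; split=> // [g|i]; last first.
  rewrite inE => /allP; apply.
  by rewrite mulrC (perm_mem (msuppMX _ _)) map_f.
have CsubP h : var_prime C h -> P h.
  apply: (monomial_ideal_sub PI) => u /meetsP[i Ci ui].
  rewrite -[u](@submK _ U_(i)%MM).
    by rewrite mpolyXD; apply: (idealM PI); apply/CP.
  by apply/mnm_lepP=> j; rewrite mnm1E; case: eqP => // <-.
split=> [Pg|]; last exact: CsubP.
have [g' [hg ng]] := monomial_reduce (meets C) g.
have [g0|g0] := eqVneq g' 0; first by rewrite g0 subr0 in hg.
have Pg' : P g' by rewrite -[g'](subKr g); apply: (idealB PI Pg); apply: CsubP.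
have [k hk] := monomial_colon_lead upS g0 ((hf _).1 Pg').
have [i lt_i /CP Ci] := prime_monomial Pp ((hf _).2 hk).
case/meetsP: (ng _ (mlead_supp g0)); exists i => //.
by move: lt_i; rewrite mulmnE muln_gt0 => /andP[].
Qed.

(** The hypotheses give [S (u + m)] exactly when [u] meets [C], so the colon ideal by ['X_[m]] is
    [var_prime C]. *)
Lemma associated_var S C m : {in C, forall i, S (U_(i) + m)%MM} ->
  upclosed S -> (forall u, ~~ meets C u -> ~~ S (u + m)%MM) ->
  associated_prime (monomial_ideal S) (var_prime C).
Proof.
move=> hC upS hn; split; first exact: is_prime_var.
have hS u : S (u + m)%MM = meets C u.
  apply/idP/idP => [|/meetsP[i Ci ui]]; first by apply: contraLR => /hn.
  rewrite -[u](@submK _ U_(i)%MM); first by rewrite -addmA; apply/upS/hC.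
  by apply/mnm_lepP=> j; rewrite mnm1E; case: eqP => // <-.
exists 'X_[m] => g; split=> /allP h; apply/allP=> u.
  by rewrite (perm_mem (msuppMX _ _)) => /mapP[v gv ->]; rewrite addmC hS; apply: h.
by move=> gu; rewrite -hS addmC; apply: h; rewrite (perm_mem (msuppMX _ _)) map_f.
Qed.

Lemma var_prime_strict C C' : C \proper C' ->
  strict_sub (var_prime C) (var_prime C').
Proof.
case/properP=> /subsetP sCC [i iC' iC]; split.
  move=> f; apply: sub_all => u /meetsP[j /sCC Cj uj]; apply/meetsP; by exists j.
exists 'X_i; first by apply/monomial_idealX; rewrite meets1.
by move/monomial_idealX; rewrite meets1 (negPf iC).
Qed.

End MonomialIdeals.

(** * Heights of primes in a commutative ring *)

Section Heights.
Variable R : comNzRingType.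
Implicit Types P Q : R -> Prop.

Lemma prime_chain_eq P Q h C : (forall f, P f <-> Q f) ->
  prime_chain P h C -> prime_chain Q h C.
Proof. by move=> PQ [pC sC eC]; split=> // f; rewrite eC. Qed.

Lemma has_height_eq P Q h : (forall f, P f <-> Q f) ->
  has_height P h <-> has_height Q h.
Proof.
suff W P' Q' : (forall f, P' f <-> Q' f) -> has_height P' h -> has_height Q' h.
  by move=> PQ; split; apply: W => // f; rewrite PQ.
move=> PQ [[C chC] maxP]; split; first by exists C; apply: prime_chain_eq chC.
move=> k C'; move/(prime_chain_eq (Q := P')) => h'; apply: (maxP _ C').
by apply: h' => f; rewrite PQ.
Qed.

Lemma prime_chain_pullback (phi psi : {rmorphism R -> R}) P h C :
  cancel psi phi -> prime_chain P h C ->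
  prime_chain (fun f => P (phi f)) h (fun i f => C i (phi f)).
Proof.
move=> phiK [pC sC eC]; split=> [i /pC|i /sC|f]; last exact: eC.
- move=> [[C0 CD CM] C1 Cp]; split; first split.
  + by rewrite rmorph0.
  + by move=> a b Ca Cb; rewrite rmorphD; apply: CD.
  + by move=> a b Cb; rewrite rmorphM; apply: CM.
  + by rewrite rmorph1.
  + by move=> a b; rewrite rmorphM => /Cp.
- move=> [sub [f f1 f2]]; split=> [g /sub //|].
  by exists (psi f); rewrite phiK.
Qed.

Lemma has_height_pullback (phi psi : {rmorphism R -> R}) P h :
  cancel psi phi -> cancel phi psi ->
  has_height (fun f => P (phi f)) h <-> has_height P h.
Proof.
move=> phiK psiK.
have eP f : P (phi (psi f)) <-> P f by rewrite phiK.
split=> -[[C chC] maxP]; split.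
- exists (fun i f => C i (psi f)); apply: prime_chain_eq eP _.
  exact: (prime_chain_pullback psiK chC).
- by move=> k C' /(prime_chain_pullback phiK) /maxP.
- by exists (fun i f => C i (phi f)); apply: prime_chain_pullback phiK _.
- move=> k C' /(prime_chain_pullback psiK) /(prime_chain_eq eP).
  exact: maxP.
Qed.

(** Appending [Q] to a chain of length [h] ending in [P] gives a chain of length [h.+1] ending in
    [Q]. *)
Lemma has_height_strict P Q h : is_prime Q -> strict_sub P Q ->
  has_height P h -> ~ has_height Q h.
Proof.
move=> pQ sPQ [[C [pC sC eC]] _] [_ /(_ h.+1 (fun i => if (i <= h)%N then C i else Q))].
move=> H; have : (h.+1 <= h)%N; last by rewrite ltnn.
apply: H; split=> [i|i|f].
- by case: ifP => [/pC|].
- rewrite ltnS => le_ih; rewrite le_ih; case: ifP => [/sC //|].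
  move=> /negbT; rewrite -ltnNge ltnS => le_hi.
  have -> : i = h by apply/eqP; rewrite eqn_leq le_ih.
  case: sPQ => sub [f Qf Pf]; split=> [g /eC /sub //|].
  by exists f => // /eC.
- by rewrite ltnn.
Qed.

(** Without a height, every chain could be prolonged, past the bound [b]. The double negation is
    there because choosing a longest chain is not constructive. *)
Lemma has_height_bounded P b : is_prime P ->
  (forall h C, prime_chain P h C -> (h <= b)%N) -> ~ ~ exists h, has_height P h.
Proof.
move=> pP bound nh.
suff H k : ~ ~ exists h C, (k <= h)%N /\ prime_chain P h C.
  by apply: (H b.+1) => -[h [C [lt_bh /bound]]]; rewrite leqNgt lt_bh.
elim: k => [|k IH] nk.
  by apply: nk; exists 0%N, (fun _ => P).
apply: IH => -[h [C [le_kh chC]]]; apply: nh; exists h; split; first by exists C.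
move=> l C' chC'; rewrite leqNgt; apply/negP => lt_hl; apply: nk.
by exists l, C'; rewrite (leq_ltn_trans le_kh).
Qed.

End Heights.

(** * Bounded chains of primes in a polynomial ring, and invariance of height under permuting
    variables *)

Section PolynomialHeights.
Variables (K : fieldType) (N : nat).
Local Notation R := {mpoly K[N]}.

(** Exponent vectors of length [h] with entries below [d], as nested pairs so that an induction can
    split off the exponent of [f 0]. *)
Fixpoint box (d h : nat) : finType :=
  if h is h'.+1 then ('I_d * box d h')%type : finType else unit.

Lemma card_box d h : #|box d h| = (d ^ h)%N.
Proof. by elim: h => [|h IH] /=; rewrite ?card_unit // card_prod IH card_ord expnS. Qed.

Fixpoint box_monomial (f : nat -> R) d h : box d h -> R :=
  if h is h'.+1 then
    fun a : 'I_d * box d h' =>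
      f 0%N ^+ a.1 * box_monomial (fun i => f i.+1) a.2
  else fun _ => 1.

(* If g(f_0, ..., f_(h-1)) lies in C_0, then modulo C_1 the terms divisible by
   f_0 disappear; the others vanish by induction on the chain, and then one may
   divide by f_0, which is not in the prime C_0. *)
Lemma chain_independent (C : nat -> R -> Prop) (f : nat -> R) h d
    (c : box d h -> K) :
  (forall i, (i <= h)%N -> is_prime (C i)) ->
  (forall i g, (i < h)%N -> C i g -> C i.+1 g) ->
  (forall i, (i < h)%N -> C i.+1 (f i) /\ ~ C i (f i)) ->
  C 0%N (\sum_a c a *: box_monomial f a) -> c =1 fun=> 0.
Proof.
elim: h C f c => [|h IH] C f c pC sC fC.
  rewrite (big_pred1 tt) => [|[] //] /= Cc [].
  have [PI P1 _] := pC 0%N isT; apply/eqP/negPn/negP => c0; apply: P1.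
  rewrite -[1](scalerK c0) -mul_mpolyC; exact: (idealM PI).
have [PI P1 PM] := pC 0%N isT; have [PI' _ _] := pC 1%N isT.
have [f1 f0] := fC 0%N isT.
pose r (c' : box d h -> K) : R :=
  \sum_(a : box d h) c' a *: box_monomial (fun i => f i.+1) a.
have step c' : C 1%N (r c') -> c' =1 fun=> 0.
  by apply: (IH (fun i => C i.+1)) => [i|i g|i] lt_i;
    [apply: pC | apply: sC | apply: fC].
(* The number [e] of powers of [f 0] is decoupled from [d], so that dividing by [f 0] becomes an
   induction on [e]. *)
have slices e (c' : 'I_e -> box d h -> K) :
    C 0%N (\sum_(k < e) f 0%N ^+ k * r (c' k)) -> forall k, c' k =1 fun=> 0.
  elim: e c' => [|e IHe] c' Cc k; first by case: k.
  have c'0 : c' ord0 =1 fun=> 0.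
    apply: step; move: (sC 0%N _ isT Cc); rewrite big_ord_recl mul1r => C1.
    rewrite -[X in C _ X](addrK (\sum_(i < e) f 0%N ^+ lift ord0 i * r (c' (lift ord0 i)))).
    apply: (idealB PI') => //.
    apply: ideal_sum => // i _; rewrite exprS -mulrA mulrC.
    exact: (idealM PI').
  have [k0|k0] := unliftP ord0 k; last by rewrite k0.
  move=> ->; apply: (IHe (fun i => c' (lift ord0 i))).
  have : C 0%N (f 0%N * \sum_(i < e) f 0%N ^+ i * r (c' (lift ord0 i))).
    move: Cc; rewrite big_ord_recl {1}/r big1 => [|a _]; last by rewrite c'0 scale0r.
    rewrite mulr0 add0r mulr_sumr; congr (C 0%N _); apply: eq_bigr => i _.
    by rewrite mulrA -exprS.
  by case/PM.
move=> Cc [k a]; apply: (slices d (fun k a => c (k, a))); move: Cc.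
congr (C 0%N _); transitivity (\sum_(k < d) \sum_(a : box d h)
    c (k, a) *: (f 0%N ^+ k * box_monomial (fun i => f i.+1) a)).
  by rewrite pair_bigA; apply: eq_bigr => -[].
apply: eq_bigr => i _; rewrite /r mulr_sumr; apply: eq_bigr => b _.
by rewrite scalerAr.
Qed.

Lemma box_monomial_mdeg (f : nat -> R) e d h (a : box d.+1 h) :
  (forall i, (i < h)%N -> {in msupp (f i), forall m, mdeg m <= e}%N) ->
  {in msupp (box_monomial f a), forall m, mdeg m <= h * (d * e)}%N.
Proof.
have expb (g : R) k : {in msupp g, forall m, mdeg m <= e}%N ->
    {in msupp (g ^+ k), forall m, mdeg m <= k * e}%N.
  move=> hg; elim: k => [|k IH] m.
    by rewrite expr0 msupp1 inE => /eqP->; rewrite mdeg0.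
  rewrite exprS => /msuppM_le /allpairsP[[u v] /= [/hg hu /IH hv ->]].
  by rewrite mdegD mulSn leq_add.
elim: h f a => [|h IH] f a hf m.
  by rewrite /= msupp1 inE => /eqP->; rewrite mdeg0.
case: a => k a /= /msuppM_le /allpairsP[[u v] /= [hu hv ->]].
rewrite mdegD mulSn leq_add //; last by apply: IH hv => i lt_i; apply: hf.
apply: leq_trans (expb _ _ (hf 0%N isT) _ hu) _.
by rewrite leq_mul2r -ltnS ltn_ord orbT.
Qed.

Lemma row_kernel (A B : finType) (M : A -> B -> K) : (#|B| < #|A|)%N ->
  exists2 c : A -> K, (exists a, c a != 0) & forall b, \sum_a c a * M a b = 0.
Proof.
move=> ltBA; pose X := \matrix_(i < #|A|, j < #|B|) M (enum_val i) (enum_val j).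
have : kermx X != 0.
  by rewrite kermx_eq0 /row_free neq_ltn (leq_ltn_trans (rank_leq_col X)).
case/rowV0Pn=> v /sub_kermxP vX v0.
exists (fun a => v 0 (enum_rank a)).
  by case/rV0Pn: v0 => i vi; exists (enum_val i); rewrite enum_valK.
move=> b; move/matrixP/(_ 0 (enum_rank b)): vX; rewrite !mxE => vXb.
rewrite -[RHS]vXb [RHS](reindex _ (onW_bij _ (@enum_rank_bij A))) /=; apply: eq_bigr => i _.
by rewrite mxE !enum_rankK.
Qed.

(** A longer chain yields [N.+1] elements whose box monomials outnumber the monomials of [N]
    variables that can occur in them. Hence they satisfy a nontrivial linear relation, against
    [chain_independent]. *)
Lemma prime_chain_bound (P : R -> Prop) h C : prime_chain P h C -> (h <= N)%N.
Proof.
move=> [pC sC _]; rewrite leqNgt; apply/negP => lt_Nh.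
have [f hf] : exists f : nat -> R, forall i, (i < N.+1)%N ->
    C i.+1 (f i) /\ ~ C i (f i).
  (* Finitely many witnesses are chosen one at a time, so no choice axiom is involved. *)
  have: (N.+1 <= h)%N by []; elim: N.+1 => [_|k IH lt_kh].
    by exists (fun _ => 0).
  have [f hf] := IH (ltnW lt_kh); have [_ [g g1 g0]] := sC k lt_kh.
  exists (fun i => if i == k then g else f i) => i; rewrite ltnS leq_eqVlt.
  by case: eqP => [-> _|_ /= /hf].
(* A common degree bound for the [f i]; the successor makes it positive, hence also [s] and [d]. *)
pose e := (\max_(i < N.+1) msize (f i)).+1.
have he i : (i < N.+1)%N -> {in msupp (f i), forall m, mdeg m <= e}%N.
  move=> lt_i m /msize_mdeg_lt /ltnW /leq_trans; apply; apply: leqW.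
  exact: (@leq_bigmax _ (fun i : 'I_N.+1 => msize (f i)) (Ordinal lt_i)).
(* [B] bounds the degree of a box monomial with exponents at most [d]. With [d = s ^ N], [(B + 1)^N
   <= (s (d + 1))^N = d (d + 1)^N < (d + 1)^(N + 1)]. *)
pose s := (N.+1 * e)%N; pose d := (s ^ N)%N; pose B := (N.+1 * (d * e))%N.
pose A := box d.+1 N.+1.
have lt_BA : (#|{ffun 'I_N -> 'I_B.+1}| < #|A|)%N.
  rewrite card_box card_ffun !card_ord.
  apply: (@leq_ltn_trans ((s * d.+1) ^ N)%N).
    have le_B : (B.+1 <= s * d.+1)%N.
      by rewrite /B mulnCA -/s mulnC mulnS -add1n leq_add2r muln_gt0.
    by case: (N) => [|k] //; rewrite leq_exp2r.
  by rewrite expnMn expnS ltn_pmul2r ?expn_gt0 // ltnS.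
have [c [a ca] hc] := row_kernel (fun (a : A) (b : {ffun 'I_N -> 'I_B.+1}) =>
  (box_monomial f a)@_[multinom (b i : nat) | i < N]) lt_BA.
move: ca; rewrite (@chain_independent C f N.+1 d.+1 c) ?eqxx //.
- by move=> i le_i; apply: pC; apply: leq_trans le_i _.
- by move=> i g lt_i; case: (sC i (leq_trans lt_i lt_Nh)) => sub _; apply: sub.
suff -> : \sum_a c a *: box_monomial f a = 0.
  by case: (pC 0%N isT) => PI _ _; apply: (ideal0 PI).
apply/mpolyP=> m; rewrite mcoeff0 raddf_sum /=.
have [mB|mB] := boolP [forall i, m i < B.+1]%N.
  move/forallP: mB => mB; rewrite -[RHS](hc [ffun i => Ordinal (mB i)]).
  apply: eq_bigr => b _; rewrite mcoeffZ; congr (_ * _@__).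
  by apply/mnmP=> i; rewrite mnmE ffunE.
(* A monomial with an exponent above [B] occurs in no box monomial, by the degree bound. *)
apply: big1 => b _; rewrite mcoeffZ memN_msupp_eq0 ?mulr0 //.
apply: contra mB => /(box_monomial_mdeg he) mB; apply/forallP=> i.
by rewrite ltnS; apply: leq_trans mB; rewrite mdegE (bigD1 i) //= leq_addr.
Qed.

(** List each set followed by its complement and match the two lists position by position. The
    default of [nth] is never reached. *)
Lemma perm_of_card (C C' : {set 'I_N}) : #|C| = #|C'| ->
  exists s : 'S_N, forall i, (s i \in C') = (i \in C).
Proof.
move=> eqC; pose e (D : {set 'I_N}) := enum D ++ enum (~: D).
have eD D i : i \in e D by rewrite mem_cat !mem_enum inE orbN.
have eU D : uniq (e D).
  rewrite cat_uniq !enum_uniq andbT; apply/hasPn=> i.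
  by rewrite !mem_enum inE.
have sz : size (e C) = size (e C').
  by apply/eqP; rewrite -uniq_size_uniq // => i; rewrite !eD.
pose F i := nth i (e C') (index i (e C)).
have F_inj : injective F.
  move=> i j; rewrite /F (set_nth_default i j) -?sz ?index_mem //.
  move/eqP; rewrite nth_uniq -?sz ?index_mem // => /eqP eq_ij.
  by rewrite -[i](nth_index i (eD C i)) eq_ij nth_index.
exists (perm F_inj) => i; rewrite permE /F nth_cat index_cat !mem_enum -!cardE -eqC.
have [iC|iC] := boolP (i \in C).
  have lt_i : (index i (enum C) < #|C|)%N by rewrite cardE index_mem mem_enum.
  by rewrite lt_i -mem_enum mem_nth // -cardE -eqC.
rewrite ltnNge leq_addr /= addKn; apply: negbTE; rewrite -in_setC -mem_enum.
apply: mem_nth; move: sz; rewrite !size_cat -!cardE eqC => /addnI <-.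
by rewrite cardE index_mem mem_enum inE.
Qed.

Lemma meets_perm (C C' : {set 'I_N}) (s : 'S_N) (m : 'X_{1..N}) :
  (forall i, (s i \in C) = (i \in C')) -> meets C' [multinom m (s i) | i < N] = meets C m.
Proof.
move=> Cs; apply/meetsP/meetsP => -[i iC mi].
  by exists (s i); rewrite ?Cs //; rewrite mnmE in mi.
by exists ((s^-1)%g i); rewrite -?Cs ?mnmE permKV.
Qed.

Lemma var_prime_msym (C C' : {set 'I_N}) (s : 'S_N) f :
  (forall i, (s i \in C) = (i \in C')) ->
  var_prime C (msym s f) <-> @var_prime K N C' f.
Proof.
move=> Cs; split=> /monomial_idealP hf; apply/monomial_idealP=> m.
  by rewrite -(mpermK s m) -mcoeff_sym (meets_perm _ Cs) => /hf.
by rewrite mcoeff_sym -(meets_perm _ Cs) => /hf.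
Qed.

(** An automorphism permuting the variables carries one prime to the other and preserves chains. *)
Lemma has_height_var_prime_card (C C' : {set 'I_N}) h : #|C| = #|C'| ->
  has_height (@var_prime K N C) h <-> has_height (@var_prime K N C') h.
Proof.
move=> /esym/perm_of_card[s hs].
rewrite -(@has_height_pullback _ (msym s) (msym s^-1)%g (var_prime C)).
- by apply: has_height_eq => f; rewrite (var_prime_msym _ hs).
- by move=> f; rewrite /= -msymMm mulVg msym1m.
- by move=> f; rewrite /= -msymMm mulgV msym1m.
Qed.

End PolynomialHeights.

(** * Unmixedness depends only on the elements of the ideal *)

Section Unmixed.
Variable R : comNzRingType.
Implicit Types I J P : R -> Prop.

Lemma associated_prime_sub I P f : is_ideal I -> associated_prime I P ->
  I f -> P f.
Proof.
by move=> [_ _ IM] [_ [g hg]] If; apply/hg; rewrite mulrC; apply: IM.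
Qed.

Lemma associated_prime_eq I J P : (forall f, I f <-> J f) ->
  associated_prime I P -> associated_prime J P.
Proof. by move=> IJ [pP [f hf]]; split=> //; exists f => g; rewrite -IJ. Qed.

Lemma unmixed_eq I J : (forall f, I f <-> J f) -> unmixed I <-> unmixed J.
Proof.
suff W I' J' : (forall f, I' f <-> J' f) -> unmixed I' -> unmixed J'.
  by move=> IJ; split; apply: W => // f; rewrite IJ.
move=> IJ uI P Q JP JQ; have JI f : J' f <-> I' f by rewrite IJ.
by apply: uI; apply: (associated_prime_eq JI).
Qed.

End Unmixed.

(** * Vertex covers and associated primes of an edge ideal *)

Section EdgeMonomials.
Variables (K : fieldType) (N : nat) (E : rel 'I_N) (w : 'I_N -> nat).
Hypothesis Eirr : irreflexive E.
Implicit Types (C : {set 'I_N}) (m : 'X_{1..N}).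

Definition edge_divides m :=
  [exists e : 'I_N * 'I_N, [&& E e.1 e.2, 0 < m e.1 & w e.2 <= m e.2]]%N.

Lemma edge_dividesP m :
  reflect (exists a b, [/\ E a b, 0 < m a & w b <= m b]%N) (edge_divides m).
Proof.
apply: (iffP existsP) => [[[a b] /and3P[]]|[a [b [h1 h2 h3]]]]; first by exists a, b.
by exists (a, b); apply/and3P.
Qed.

Lemma edge_divides_upclosed : upclosed edge_divides.
Proof.
move=> u m /edge_dividesP[a [b [Eab ma mb]]]; apply/edge_dividesP; exists a, b.
by rewrite !mnmDE addn_gt0 ma orbT (leq_trans mb) ?leq_addl.
Qed.

Lemma edge_divides_gen a b : E a b -> edge_divides (U_(a) + U_(b) *+ w b)%MM.
Proof.
move=> Eab; apply/edge_dividesP; exists a, b.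
by rewrite !mnmDE !mulmnE !mnm1E !eqxx mul1n leq_addl.
Qed.

Definition vcover C := forall a b, E a b -> (a \in C) || (b \in C).

(** [P] contains every edge generator, and a monomial in [var_prime C] involves a variable of
    [C]. *)
Lemma associated_vcover C P : associated_prime (monomial_ideal edge_divides) P ->
  (forall f : {mpoly K[N]}, P f <-> var_prime C f) -> vcover C.
Proof.
move=> aP PC a b Eab; have [bC|bC] := boolP (b \in C); rewrite ?orbT ?orbF //.
have : P 'X_[U_(a) + U_(b) *+ w b].
  apply: associated_prime_sub aP _; first exact/is_ideal_monomial/edge_divides_upclosed.
  exact/monomial_idealX/edge_divides_gen.
move/PC/monomial_idealX/meetsP=> [i iC]; rewrite mnmDE mulmnE !mnm1E.
case: eqP => [->//|_]; case: eqP => [eb|_]; last by rewrite mul0n.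
by rewrite eb iC in bC.
Qed.

(* The condition says that C is a strong vertex cover: the witness monomial has
   exponent 0 at the vertices of C with an out-neighbour outside C, w - 1 at the
   other vertices of C, and a large exponent outside C. *)
Lemma associated_strong_vcover C : (forall a, 0 < w a)%N -> vcover C ->
  {in C, forall v,
     (exists2 b, E v b & b \notin C) \/
     (exists2 a, E a v & a \notin C \/
        (1 < w a)%N /\ (forall b, E a b -> b \in C))} ->
  associated_prime (monomial_ideal edge_divides) (@var_prime K N C).
Proof.
move=> w_gt0 cC sC; pose out v := [exists b, E v b && (b \notin C)].
pose W := (\max_a w a)%N; have leW a : (w a <= W)%N by apply: leq_bigmax.
pose m := [multinom if v \in C then if out v then 0 else (w v).-1 else W | v < N]%N.
have mnC v : v \notin C -> (w v <= m v)%N by move=> /negPf vC; rewrite mnmE vC.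
apply: (@associated_var _ _ _ _ m); last 2 first.
- exact: edge_divides_upclosed.
- move=> u uC; apply/edge_dividesP=> -[a [b [Eab]]]; rewrite !mnmDE.
  have uC0 v : v \in C -> u v = 0%N.
    by move=> vC; apply/eqP; rewrite -leqn0 leqNgt; apply: contra uC => uv;
      apply/meetsP; exists v.
  have [bC|bC] := boolP (b \in C).
    rewrite (uC0 b) // [m b]mnmE bC => _; case: ifP => _.
      by rewrite leqNgt w_gt0.
    by rewrite leqNgt prednK // leqnn.
  have aC : a \in C by have := cC _ _ Eab; rewrite (negPf bC) orbF.
  rewrite uC0 // mnmE aC (_ : out a) //.
  by apply/existsP; exists b; rewrite Eab.
move=> v vC; have neq a b : E a b -> (a == b) = false.
  by move=> Eab; apply/eqP => eab; rewrite eab Eirr in Eab.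
have [ov|nov] := boolP (out v).
  case/existsP: ov => b /andP[Evb bC]; apply/edge_dividesP; exists v, b.
  by rewrite !mnmDE !mnm1E eqxx (neq _ _ Evb) mnC.
case: (sC v vC) => [[b Evb bC]|[a Eav ha]].
  by case/existsP: nov; exists b; rewrite Evb.
apply/edge_dividesP; exists a, v; rewrite !mnmDE !mnm1E eqxx; split=> //; last first.
  by rewrite mnmE vC (negPf nov) add1n prednK.
rewrite addn_gt0; apply/orP; right.
have [aC|aC] := boolP (a \in C); last exact: leq_trans (w_gt0 a) (mnC _ aC).
case: ha => [|[wa aout]]; first by rewrite aC.
rewrite mnmE aC; case: ifP => [/existsP[b /andP[/aout ->]] //|_].
by rewrite -ltnS prednK.
Qed.

End EdgeMonomials.

(** * The equivalence for whiskers whose vertices are indices of variables *)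

Section Whisker.
Variables (K : fieldType) (N n : nat) (E : rel 'I_N) (w : 'I_N -> nat).
Variables X Y : 'I_n -> 'I_N.
Hypothesis Eirr : irreflexive E.
Hypothesis Easym : forall a b, E a b -> ~~ E b a.
Hypothesis w_gt0 : forall a, (0 < w a)%N.
Hypothesis w_source : forall a, (forall b, ~~ E b a) -> w a = 1%N.
Hypothesis XYcover : forall v, (exists i, v = X i) \/ (exists i, v = Y i).
Hypothesis Xinj : injective X.
Hypothesis Yinj : injective Y.
Hypothesis XY : forall i j, X i != Y j.
Hypothesis whisker_edge : forall i, E (X i) (Y i) || E (Y i) (X i).
Hypothesis whisker_leaf : forall v i, E v (Y i) || E (Y i) v -> v = X i.

Local Notation S := (edge_divides E w).
Local Notation I := (@monomial_ideal K N S).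

(** Selecting whichever of [X i], [Y i] lies in [C] is a bijection from the indices onto [C]. *)
Lemma card_half (C : {set 'I_N}) :
  (forall i, (X i \in C) = (Y i \notin C)) -> #|C| = n.
Proof.
move=> hC; pose F i := if X i \in C then X i else Y i.
have FC i : F i \in C by rewrite /F; case: ifP => //; rewrite hC => /negbFE.
have F_inj : injective F.
  move=> i j; rewrite /F; case: ifP => _; case: ifP => _.
  - exact: Xinj.
  - by move=> e; have := XY i j; rewrite e eqxx.
  - by move=> e; have := XY j i; rewrite e eqxx.
  - exact: Yinj.
rewrite -[RHS]card_ord -(card_imset _ F_inj); apply: eq_card => v.
apply/idP/imsetP => [vC|[i _ ->] //].
case: (XYcover v) => -[i eq_v]; exists i => //; rewrite /F -?hC -eq_v ?vC //.
by rewrite hC -eq_v vC.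
Qed.

Lemma whisker_associated P :
  (forall i, E (X i) (Y i) -> w (X i) = 1%N) -> associated_prime I P ->
  exists2 C : {set 'I_N}, #|C| = n & forall f, P f <-> var_prime C f.
Proof.
move=> w1 aP.
have [C [m [PC Sm Sadd]]] := associated_monomial (@edge_divides_upclosed _ E w) aP.
have cC := associated_vcover aP PC.
exists C => //; apply: card_half => i.
have [YC|YC] := boolP (Y i \in C); last first.
  by case/orP: (whisker_edge i) => /cC; rewrite (negPf YC) ?orbF.
apply/negP=> XC.
(* m is divisible by the weighted X i, so multiplying m by X i creates no new
   divisor. *)
have wm : (0 < m (X i) /\ w (X i) <= m (X i))%N.
  case/edge_dividesP: (Sadd _ YC) => a [b [Eab]]; rewrite !mnmDE !mnm1E.
  have [ea|na] := eqVneq (Y i) a.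
    have eb : b = X i by apply: whisker_leaf; rewrite ea Eab orbT.
    rewrite eb eq_sym (negPf (XY _ _)) add0n => _ h; split=> //.
    exact: leq_trans (w_gt0 _) h.
  have [eb|nb] := eqVneq (Y i) b.
    have ea : a = X i by apply: whisker_leaf; rewrite eb Eab.
    rewrite add0n ea => h _; split=> //.
    by rewrite w1 // -ea eb.
  rewrite !add0n => h1 h2; case/negP: Sm; apply/edge_dividesP; by exists a, b.
case: wm => m_gt0 m_ge.
case/edge_dividesP: (Sadd _ XC) => a [b [Eab]]; rewrite !mnmDE !mnm1E => ha hb.
case/negP: Sm; apply/edge_dividesP; exists a, b; split=> //.
  by move: ha; case: eqP => [<-|].
by move: hb; case: eqP => [<-|].
Qed.

Lemma whisker_unmixed :
  unmixed I <-> (forall i, E (X i) (Y i) -> w (X i) = 1%N).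
Proof.
split=> [uI i Ei | w1 P Q aP aQ h]; last first.
  have [C cC PC] := whisker_associated w1 aP.
  have [C' cC' QC'] := whisker_associated w1 aQ.
  rewrite (has_height_eq h PC) (has_height_eq h QC').
  by apply: has_height_var_prime_card; rewrite cC cC'.
apply/eqP/negPn/negP => wi.
have w_gt1 : (1 < w (X i))%N by rewrite ltn_neqAle eq_sym wi w_gt0.
have [j Ej] : exists j, E (X j) (X i).
  have [v Ev|noin] := pickP (fun v => E v (X i)); last first.
    by case/eqP: wi; apply: w_source => b; rewrite noin.
  case: (XYcover v) => -[j ev]; first by exists j; rewrite -ev.
  (* The in-neighbour cannot be a leaf: it would be [Y i], whose edge has the opposite direction. *)
  have ji : X i = X j by apply: whisker_leaf; rewrite -ev Ev orbT.
  by have := Easym Ei; rewrite (Xinj ji) -ev -(Xinj ji) Ev.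
pose C := [set v | (v == Y j) || [exists k, (k != j) && (v == X k)]].
have XC k : (X k \in C) = (k != j).
  rewrite inE (negPf (XY _ _)); apply/existsP/idP => [[l /andP[lj /eqP/Xinj->]] //|kj].
  by exists k; rewrite kj eqxx.
have YC k : (Y k \in C) = (k == j).
  rewrite inE (inj_eq Yinj); case: eqP => //= _; apply/existsP=> -[l /andP[_]].
  by rewrite eq_sym (negPf (XY _ _)).
(* The complement of [C], namely [X j] and the [Y k] with [k] other than [j], is independent. *)
have nbrC a b : a \notin C -> E a b || E b a -> b \in C.
  move=> aC e; case: (XYcover a) aC e => -[k ->]; rewrite ?XC ?YC => kj e.
    have {}kj : k = j by apply/eqP; rewrite -[_ == _]negbK.
    case: (XYcover b) e => -[l ->]; rewrite ?XC ?YC kj.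
      by apply: contraL => /eqP->; rewrite Eirr.
    by move/whisker_leaf/Xinj->.
  by rewrite orbC in e; rewrite (whisker_leaf e) XC.
have coverC (C' : {set 'I_N}) : C \subset C' -> vcover E C'.
  move=> /subsetP sCC' a b Eab; apply/orP.
  have [aC|/nbrC aC] := boolP (a \in C); first by left; apply: sCC'.
  by right; apply/sCC'/aC; rewrite Eab.
have outside (C' : {set 'I_N}) v b : E v b || E b v -> b \notin C' ->
    (exists2 b', E v b' & b' \notin C') \/
    (exists2 a, E a v & a \notin C' \/
       (1 < w a)%N /\ (forall b', E a b' -> b' \in C')).
  by case/orP=> e bC'; [left; exists b | right; exists b => //; left].
have EYX k : E (Y k) (X k) || E (X k) (Y k) by rewrite orbC whisker_edge.
have aP : associated_prime I (var_prime C).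
  apply: associated_strong_vcover => //; first exact: coverC.
  move=> v vC; case: (XYcover v) vC => -[k ->]; rewrite ?XC ?YC => kj.
    by apply: (outside _ _ (Y k)); rewrite ?whisker_edge ?YC.
  by apply: (outside _ _ (X k)); rewrite ?EYX ?XC ?kj.
have aQ : associated_prime I (var_prime (Y i |: C)).
  apply: associated_strong_vcover => //; first exact/coverC/subsetUr.
  move=> v; rewrite in_setU1; case: eqP => [-> _|_ /= vC].
    (* For the added vertex [Y i], the in-neighbour [X i] has weight above 1 and all its
       out-neighbours in the cover: its leaf is [Y i], and [X j] points towards it. *)
    right; exists (X i) => //; right; split=> // b Eib; rewrite in_setU1.
    case: (XYcover b) Eib => -[k ->] Eib; rewrite ?XC ?YC.
      rewrite (negPf (XY _ _)) /=.
      by apply: contraL Eib => /eqP->; apply: Easym.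
    have ki : X i = X k by apply: whisker_leaf; rewrite Eib.
    by rewrite (Xinj ki) eqxx.
  have XC' : X j \notin Y i |: C by rewrite in_setU1 (negPf (XY _ _)) XC eqxx.
  case: (XYcover v) vC => -[k ->]; rewrite ?XC ?YC => kj; last first.
    by rewrite (eqP kj); apply: (outside _ _ (X j)) => //; apply: EYX.
  (* The leaf of [X i] now lies in the cover, so [X j] serves as its outside neighbour; any other
     [X k] still has [Y k]. *)
  have [->|ki] := eqVneq k i; first by apply: (outside _ _ (X j)); rewrite ?Ej ?orbT.
  apply: (outside _ _ (Y k)); rewrite ?whisker_edge //.
  by rewrite in_setU1 (inj_eq Yinj) (negPf ki) YC.
have sPQ : strict_sub (@var_prime K N C) (var_prime (Y i |: C)).
  apply: var_prime_strict; apply: properUr.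
  by rewrite sub1set YC; apply: contraTneq Ej => ->; rewrite Eirr.
have bound h chain : prime_chain (@var_prime K N C) h chain -> (h <= N)%N.
  exact: prime_chain_bound.
(* The goal is [False], so the doubly negated existence of a height suffices. *)
apply: (has_height_bounded (is_prime_var _ _) bound) => -[h hP].
by apply: (has_height_strict (is_prime_var _ _) sPQ hP); apply/(uI _ _ aP aQ).
Qed.

End Whisker.

(** * From weighted oriented graphs to relations on indices *)

(** Since an edge has distinct ends, the two separate exponent conditions of [edge_divides] amount
    to divisibility by the edge generator. *)
Lemma edge_ideal_monomial (K : fieldType) (T : finType) (H : wograph T) f :
  edge_ideal K H f <-> monomial_ideal
    (edge_divides (fun i j => (enum_val i, enum_val j) \in edges H)
       (fun i => weight H (enum_val i))) f.
Proof.
set E := fun i j => _ \in _; set w := fun i => weight _ _.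
have upS := @edge_divides_upclosed _ E w.
split=> [|hf J idJ genJ].
  apply; first exact: is_ideal_monomial.
  move=> _ [i [j [Eij ->]]]; rewrite mpolyXn -mpolyXD.
  exact/monomial_idealX/edge_divides_gen.
apply: (monomial_ideal_sub idJ) hf => m /edge_dividesP[i [j [Eij mi mj]]].
have ij : i != j.
  by apply/eqP=> eij; have := edges_irrefl H (enum_val j); rewrite /E eij in Eij *; rewrite Eij.
have le_m : (U_(i) + U_(j) *+ w j <= m)%MM.
  apply/mnm_lepP=> k; rewrite mnmDE mulmnE !mnm1E.
  case: (eqVneq i k) => [<-|_]; first by rewrite eq_sym (negPf ij).
  by case: eqP => [<-|_]; rewrite ?mul1n ?mul0n.
rewrite -(submK le_m) mpolyXD; apply: (idealM idJ); apply: genJ.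
by exists i, j; split=> //; rewrite mpolyXn mpolyXD.
Qed.

Section WhiskerEdges.
Variables (T : finType) (D H : wograph T) (n : nat) (x y : 'I_n -> T).
Hypothesis hDH : wowhisker D H x y.

Lemma mem_uedges (G : wograph T) a b :
  ([set a; b] \in uedges G) = ((a, b) \in edges G) || ((b, a) \in edges G).
Proof.
apply/imsetP/orP => [[[c d] Ecd /= eqs]|[e|e]]; last 2 first.
- by exists (a, b).
- by exists (b, a); rewrite // setUC.
have : (a \in [set c; d]) && (b \in [set c; d]) by rewrite -eqs !inE !eqxx orbT.
have : (c \in [set a; b]) && (d \in [set a; b]) by rewrite eqs !inE !eqxx orbT.
have ncd : c != d by apply: contraTneq Ecd => ->; apply: edges_irrefl.
rewrite !inE => /andP[/orP[]/eqP ec /orP[]/eqP ed] _; subst.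
- by rewrite eqxx in ncd.
- by left.
- by right.
- by rewrite eqxx in ncd.
Qed.

Lemma whisker_edgeE i : ((x i, y i) \in edges H) || ((y i, x i) \in edges H).
Proof.
case: hDH => _ [_ _ _ /= eE]; rewrite -mem_uedges.
rewrite eE inE; apply/orP; right; exact: imset_f.
Qed.

(** As [y i] is not a vertex of [D], an edge at it must be one of the added edges, and injectivity
    of [y] identifies which. *)
Lemma whisker_leafE v i :
  ((v, y i) \in edges H) || ((y i, v) \in edges H) -> v = x i.
Proof.
case: hDH => _ [[_ eV] [yinj yV] _ /= eE]; rewrite -mem_uedges.
rewrite eE inE => /orP[/uedges_vertices/subsetP|].
  by move/(_ (y i)); rewrite !inE eqxx orbT => /(_ isT) h; case/negP: (yV i).
have xy j k : x j != y k.
  by apply: contraNneq (yV k) => <-; rewrite eV imset_f.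
case/imsetP=> j _ /= eqs.
have : y i \in [set x j; y j] by rewrite -eqs !inE eqxx orbT.
rewrite !inE eq_sym (negPf (xy _ _)) => /eqP/yinj ij; subst j.
have : x i \in [set v; y i] by rewrite eqs !inE eqxx.
by rewrite !inE (negPf (xy _ _)) orbF => /eqP.
Qed.

End WhiskerEdges.

Theorem theorem4p16 (K : fieldType) (T : finType) (D H : wograph T)
    (n : nat) (x y : 'I_n -> T)
    (hDH : wowhisker D H x y)
    (hsource : forall a : T, source H a -> weight H a = 1%N) :
  unmixed (edge_ideal K H) <->
  (forall i : 'I_n, (x i, y i) \in edges H -> weight H (x i) = 1%N).
Proof.
have [_ [[xinj /= eV] [yinj /= yV] /= eVH _]] := hDH.
have xH i : x i \in vertices H.
  by rewrite eVH eV inE imset_f.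
have yH i : y i \in vertices H.
  by rewrite eVH inE imset_f ?orbT.
pose X i := enum_rank_in (xH i) (x i); pose Y i := enum_rank_in (yH i) (y i).
have eX i : enum_val (X i) = x i by apply: enum_rankK_in.
have eY i : enum_val (Y i) = y i by apply: enum_rankK_in.
rewrite (unmixed_eq (@edge_ideal_monomial K T H)) (@whisker_unmixed _ _ n _ _ X Y).
- by split=> h i; have := h i; rewrite eX eY.
- by move=> a; apply/negbTE/edges_irrefl.
- by move=> a b; apply: edges_asym.
- by move=> a; apply/weight_gt0/enum_valP.
(* [na] speaks only of indices, that is of vertices of [H]; every in-neighbour is one. *)
- move=> a na; apply: hsource; split=> [|b]; first exact: enum_valP.
  apply/negP=> e; case/andP: (edges_vertices e) => bH _.
  by have := na (enum_rank_in bH b); rewrite enum_rankK_in // e.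
- move=> v; have := enum_valP v; set z := enum_val v => zH.
  have : z \in [set x i | i : 'I_n] :|: [set y i | i : 'I_n] by rewrite -eV -eVH.
  rewrite inE => /orP[] /imsetP[i _ ei]; [left | right]; exists i; apply: enum_val_inj.
    by rewrite -/z ei eX.
  by rewrite -/z ei eY.
- by move=> i j e; apply: xinj; rewrite -!eX e.
- by move=> i j e; apply: yinj; rewrite -!eY e.
- move=> i j; rewrite -(inj_eq enum_val_inj) eX eY.
  by apply: contraNneq (yV j) => <-; rewrite eV imset_f.
- by move=> i; rewrite eX eY; apply: whisker_edgeE hDH i.
- by move=> v i; rewrite eY => /(whisker_leafE hDH) e; apply: enum_val_inj; rewrite e eX.
Qed.
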